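(* Let $\mathbb{F}\in\{\mathbb{R},\mathbb{C}\}$, let $H$ be a Hilbert space over $\mathbb{F}$, let $A\in B(H)$ be self-adjoint, and let $E$ be the (unique) projection-valued measure of $A$ from the Borel functional calculus. Then on the space $C_{\mathbb{F}}(\sigma(A))$ of continuous functions $\sigma(A)\to\mathbb{F}$ the Henstock–Kurzweil functional calculus $\Phi^{HK}_A$ and the continuous functional calculus $\Phi^C_A$ agree: $$\Phi^{HK}_A=\Phi^C_A\quad\text{on } C_{\mathbb{F}}(\sigma(A)).$$
   Context: Inner products are linear in the first variable; $B(H)$ is the algebra of bounded linear operators on $H$. $\Phi^C_A$ is the usual continuous functional calculus of $A$. Regulated functions: for a compact set $K\subseteq\mathbb{R}$, a function $f:K\to\mathbb{F}$ is regulated if all its left and right limits exist on $K$. $\mathrm{Reg}_{\mathbb{F}}(K)$ is the set of these functions. Measures: $E$ is the projection-valued measure on the Borel sets of $\sigma(A)$ with $A=\int_{\sigma(A)}\lambda\,dE(\lambda)$, and $\mu_{x,y}(B)=\langle E(B)x,y\rangle$ for Borel $B\subseteq\sigma(A)$ and $x,y\in H$. HK integral: let $K=\sigma(A)$. A gauge is a function $\gamma:K\to(0,\infty)$. An exhaustive $K$-division is a finite set of reals $p_0<p_1<\dots<p_n$ with $p_0<\min K$ and $\max K<p_n$. Given such a division, a $K$-cell is any set $K\cap J$ with $J$ one of $[p_{i-1},p_i]$, $[p_{i-1},p_i)$, $(p_{i-1},p_i]$, $(p_{i-1},p_i)$. A partition of $K$ is a finite collection of $K$-cells $C_1,\dots,C_m$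 with $\bigcup_jC_j=K$. A tagged partition is a partition together with points $t_1,\dots,t_m$, each sitting in precisely one $K$-cell, $t_j\in C_j$. A gauge-fine tagged partition $\widehat P_\gamma$ is a tagged partition with $C_j\subseteq(t_j-\gamma(t_j),t_j+\gamma(t_j))\cap K$ for all $j$. Its $\mu_{x,y}$-HK sum is $S(f,\mu_{x,y},\widehat P_\gamma)=\sum_jf(t_j)\mu_{x,y}(C_j)$. A function $f:K\to\mathbb{F}$ is $\mu_{x,y}$-HK-integrable with integral $I_{x,y}(f)$ if $$(\forall\varepsilon>0)(\exists\gamma\text{ a gauge})(\forall x,y\in H)(\exists I_{x,y}(f)\in\mathbb{F})(\forall\text{ gauge-fine tagged partitions }\widehat P_\gamma):\ |S(f,\mu_{x,y},\widehat P_\gamma)-I_{x,y}(f)|<\varepsilon.$$ HK functional calculus: for $f\in\mathrm{Reg}_{\mathbb{F}}(\sigma(A))$, $(x,y)\mapsto I_{x,y}(f)$ is a bounded sesquilinear form, and $\Phi^{HK}_A(f)=f(A)\in B(H)$ is the unique operator with $\langle f(A)x,y\rangle=I_{x,y}(f)$ for all $x,y\in H$.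
   Formalization: In the HK integral the gauge may depend on x and y (a gauge uniform over the unit ball is also proved for continuous f), since one gauge for all x, y in H fails even for f(t)=t; the cells of a partition are required to be pairwise disjoint. *)

(* Defs.v *)
From HB Require Import structures.
From mathcomp Require Import all_boot all_order all_algebra.
From mathcomp Require Import complex.
From mathcomp Require Import all_classical all_reals all_analysis.

Set Implicit Arguments.
Unset Strict Implicit.
Unset Printing Implicit Defensive.

Import Order.TTheory GRing.Theory Num.Theory.
Import numFieldNormedType.Exports.

Local Open Scope classical_set_scope.
Local Open Scope ring_scope.

Inductive scalar_kind := RealScalars | ComplexScalars.

Definition scalars (R : realType) (k : scalar_kind) : numFieldType :=
  match k with
  | RealScalars => (R : numFieldType)
  | ComplexScalars => (R[i] : numFieldType)
  end.

Definition of_real (R : realType) (k : scalar_kind) : R -> scalars R k :=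
  match k return R -> scalars R k with
  | RealScalars => fun r => r
  | ComplexScalars => fun r => r%:C%C
  end.

Definition conj_scalar (R : realType) (k : scalar_kind) :
    scalars R k -> scalars R k :=
  match k return scalars R k -> scalars R k with
  | RealScalars => fun z => z
  | ComplexScalars => fun z => conjc z
  end.

Definition bounded_operator (F : numFieldType) (H : normedModType F)
    (T : H -> H) : Prop :=
  linear T /\ exists M : F, forall x, `|T x| <= M * `|x|.

Definition adjoint_pair (F : numFieldType) (H : normedModType F)
    (ip : H -> H -> F) (S T : H -> H) : Prop :=
  forall x y, ip (S x) y = ip x (T y).

Definition self_adjoint (F : numFieldType) (H : normedModType F)
    (ip : H -> H -> F) (T : H -> H) : Prop := adjoint_pair ip T T.

Definition spectrum (F : numFieldType) (H : normedModType F)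
    (A : H -> H) : set F :=
  [set l | ~ exists S : H -> H, [/\ bounded_operator S,
     cancel (fun x => A x - l *: x) S & cancel S (fun x => A x - l *: x)]].

(* The spectrum of a self-adjoint operator is real, so that nothing is lost by
   pulling it back to the real line. *)
Definition real_spectrum (R : realType) (k : scalar_kind)
    (H : normedModType (scalars R k)) (A : H -> H) : set R :=
  @of_real R k @^-1` spectrum A.

(* Functions on a closed set K of reals are represented by functions R -> F of
   which only the values on K matter, and the Borel sets of K are the Borel
   sets of R that are contained in K. *)
Definition borel_subset (R : realType) (K B : set R) : Prop :=
  measurable (B : set (measurableTypeR R)) /\ B `<=` K.

Record projection_valued_measure (R : realType) (F : numFieldType)
    (H : normedModType F) (ip : H -> H -> F) (K : set R)
    (E : set R -> H -> H) : Prop := ProjectionValuedMeasure {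
  pvm_bounded : forall B, borel_subset K B -> bounded_operator (E B) ;
  pvm_self_adjoint : forall B, borel_subset K B -> self_adjoint ip (E B) ;
  pvm_set0 : forall x, E set0 x = 0 ;
  pvm_full : forall x, E K x = x ;
  pvm_setI : forall B C, borel_subset K B -> borel_subset K C ->
    forall x, E (B `&` C) x = E B (E C x) ;
  pvm_bigcup : forall B : nat -> set R, (forall n, borel_subset K (B n)) ->
    trivIset setT B ->
    forall x, (fun n => \sum_(i < n) E (B i) x) @ \oo --> E (\bigcup_n B n) x
}.

(* T is the integral over K of the bounded Borel function f with respect to E:
   T is a limit, in operator norm, of integrals of Borel simple functions that
   converge to f uniformly on K. *)
Definition spectral_integral (R : realType) (F : numFieldType)
    (H : normedModType F) (K : set R) (E : set R -> H -> H)
    (f : R -> F) (T : H -> H) : Prop :=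
  forall eps : F, 0 < eps ->
  exists (n : nat) (B : 'I_n -> set R) (c : 'I_n -> F),
    [/\ forall j, borel_subset K (B j),
        trivIset setT B /\ \bigcup_j B j = K,
        forall j t, B j t -> `|f t - c j| <= eps &
        forall x, `|T x - \sum_(j < n) c j *: E (B j) x| <= eps * `|x|].

Definition exhaustive_division (R : realType) (K : set R) (p : seq R) : Prop :=
  [/\ (1 < size p)%N, sorted <%R p &
      forall s, K s -> p`_0 < s < p`_(size p).-1].

(* The booleans b and b' range over the four choices of open or closed ends. *)
Definition K_cell (R : realType) (K : set R) (p : seq R) (C : set R) : Prop :=
  exists (i : nat) (b b' : bool), (i.+1 < size p)%N /\
    C = K `&` [set` Interval (BSide b p`_i) (BSide b' p`_i.+1)].

(* The cells of a partition are pairwise disjoint; in particular each tag sits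
   in precisely one of them. *)
Definition tagged_partition (R : realType) (K : set R) (n : nat)
    (C : 'I_n -> set R) (t : 'I_n -> R) : Prop :=
  [/\ exists2 p, exhaustive_division K p & forall j, K_cell K p (C j),
      \bigcup_j C j = K,
      trivIset setT C &
      forall j, C j (t j)].

Definition gauge (R : realType) (K : set R) (g : R -> R) : Prop :=
  forall t, K t -> 0 < g t.

Definition gauge_fine (R : realType) (K : set R) (g : R -> R) (n : nat)
    (C : 'I_n -> set R) (t : 'I_n -> R) : Prop :=
  forall j, C j `<=` [set` `]t j - g (t j), t j + g (t j)[] `&` K.

Definition hk_sum (R : realType) (F : numFieldType) (f : R -> F)
    (mu : set R -> F) (n : nat) (C : 'I_n -> set R) (t : 'I_n -> R) : F :=
  \sum_(j < n) f (t j) * mu (C j).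

Definition hk_integral (R : realType) (F : numFieldType) (K : set R)
    (mu : set R -> F) (f : R -> F) (I : F) : Prop :=
  forall eps : F, 0 < eps -> exists g : R -> R, gauge K g /\
    forall (n : nat) (C : 'I_n -> set R) (t : 'I_n -> R),
      tagged_partition K C t -> gauge_fine K g C t ->
      `|hk_sum f mu C t - I| < eps.

Definition spectral_form (R : realType) (F : numFieldType)
    (H : normedModType F) (ip : H -> H -> F) (E : set R -> H -> H)
    (x y : H) : set R -> F := fun B => ip (E B x) y.

(* A single gauge serves all x and y in the unit ball.  No gauge can serve all
   x and y in H: replacing x by a multiple of x would force all gauge-fine sums
   to be equal. *)
Definition hk_integral_unit_ball (R : realType) (F : numFieldType)
    (H : normedModType F) (K : set R) (mu : H -> H -> set R -> F)
    (f : R -> F) (I : H -> H -> F) : Prop :=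
  forall eps : F, 0 < eps -> exists g : R -> R, gauge K g /\
    forall x y : H, `|x| <= 1 -> `|y| <= 1 ->
    forall (n : nat) (C : 'I_n -> set R) (t : 'I_n -> R),
      tagged_partition K C t -> gauge_fine K g C t ->
      `|hk_sum f (mu x y) C t - I x y| < eps.

(* The unique bounded operator whose form is given by the HK integrals of f;
   [get] returns a default value if there is none. *)
Definition hk_calculus (R : realType) (F : numFieldType)
    (H : normedModType F) (ip : H -> H -> F) (K : set R)
    (E : set R -> H -> H) (f : R -> F) : H -> H :=
  get [set T : H -> H | bounded_operator T /\
    forall x y, hk_integral K (spectral_form ip E x y) f (ip (T x) y)].

(* The isometric unital *-homomorphism from C(K) to B(H) that maps the identity
   function of K to A, where K is the spectrum of A. *)
Record continuous_calculus (R : realType) (k : scalar_kind)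
    (H : normedModType (scalars R k)) (ip : H -> H -> scalars R k)
    (A : H -> H) (Phi : (R -> scalars R k) -> H -> H) : Prop :=
  ContinuousCalculus {
  cc_bounded : forall f : R -> scalars R k,
    {within real_spectrum A, continuous f} ->
    bounded_operator (Phi f) ;
  cc_linear : forall (a : scalars R k) (f g : R -> scalars R k),
    {within real_spectrum A, continuous f} ->
    {within real_spectrum A, continuous g} ->
    forall x, Phi (fun t => a * f t + g t) x = a *: Phi f x + Phi g x ;
  cc_mul : forall f g : R -> scalars R k,
    {within real_spectrum A, continuous f} ->
    {within real_spectrum A, continuous g} ->
    forall x, Phi (fun t => f t * g t) x = Phi f (Phi g x) ;
  cc_one : forall x, Phi (fun=> 1) x = x ;
  cc_star : forall f : R -> scalars R k,
    {within real_spectrum A, continuous f} ->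
    adjoint_pair ip (Phi f) (Phi (fun t => conj_scalar (f t))) ;
  cc_isometry : forall f : R -> scalars R k,
    {within real_spectrum A, continuous f} ->
    forall M, 0 <= M ->
    (forall t, real_spectrum A t -> `|f t| <= M) <->
    (forall x, `|Phi f x| <= M * `|x|) ;
  cc_id : forall x, Phi (@of_real R k) x = A x
}.

(* Main.v *)
(* Both calculi are limits of the step operators [sum_j g(t_j) E(C_j)] along fine
   tagged Borel partitions of the spectrum.  The set of continuous g for which
   these step operators converge to [Phi g] in operator norm contains the
   constants and, since A is the integral of the identity against E, the
   identity function.  As step operators multiply pointwise and are bounded by
   the sup norm of their coefficients, this set is an algebra closed under
   uniform limits, hence it is all of C(K) by Weierstrass.  Pairing the step
   operators with x and y gives the Henstock-Kurzweil sums, so [<Phi f x, y>] is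
   the HK integral of f, with a constant gauge that is uniform over the unit
   ball.  HK integrals are unique because fine partitions exist for every gauge
   (Cousin's lemma), so the HK calculus can only pick [Phi f]. *)
Require Import Defs.
From HB Require Import structures.
From mathcomp Require Import all_boot all_order all_algebra.
From mathcomp Require Import complex.
From mathcomp Require Import all_classical all_reals all_analysis.
From mathcomp Require Import ring lra.

Set Implicit Arguments.
Unset Strict Implicit.
Unset Printing Implicit Defensive.

Import Order.TTheory GRing.Theory Num.Theory.
Import numFieldNormedType.Exports.

Local Open Scope classical_set_scope.
Local Open Scope ring_scope.

(** * Scalars, inner products and resolutions of the identity *)

Section ScalarTheory.
Variables (R : realType) (k : scalar_kind).
Local Notation F := (scalars R k).
Local Notation iota := (@of_real R k).

Lemma of_real_is_additive : {morph iota : x y / x - y}.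
Proof. by case: k => x y //=; rewrite rmorphB. Qed.

Lemma of_real_is_multiplicative : monoid_morphism iota.
Proof.
by split; case: k => //= x y; rewrite rmorphM.
Qed.

HB.instance Definition _ := GRing.isZmodMorphism.Build R F iota of_real_is_additive.
HB.instance Definition _ := GRing.isMonoidMorphism.Build R F iota of_real_is_multiplicative.

Lemma ler_of_real x y : (iota x <= iota y) = (x <= y).
Proof. by case: k => //=; rewrite lecR. Qed.

Lemma ltr_of_real x y : (iota x < iota y) = (x < y).
Proof. by case: k => //=; rewrite ltcR. Qed.

Lemma normr_of_real x : `|iota x| = iota `|x|.
Proof.
case: k => //=; rewrite normc_def /= expr0n /= addr0.
by rewrite sqrtr_sqr.
Qed.

(** In the order of [R[i]] a nonnegative number has zero imaginary part, so bounds and tolerances in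
    [F] can be taken real. *)
Lemma ge0_of_real (e : F) : 0 <= e -> exists2 r, 0 <= r & e = iota r.
Proof.
case: k e => /= e e0; first by exists e.
move: (e0); rewrite lecE /= => /andP[/eqP ie re]; exists (complex.Re e) => //.
by case: e ie {e0 re} => a b /= ->.
Qed.

Lemma gt0_of_real (e : F) : 0 < e -> exists2 r, 0 < r & e = iota r.
Proof.
move=> e0; have [r _ er] := ge0_of_real (ltW e0).
by exists r => //; rewrite -ltr_of_real -er rmorph0.
Qed.

Lemma conj_scalar0 : conj_scalar (0 : F) = 0.
Proof. by case: k => //=; rewrite oppr0. Qed.

End ScalarTheory.

Section InnerProduct.
Variables (R : realType) (k : scalar_kind).
Local Notation F := (scalars R k).
Variables (H : normedModType F) (ip : {dot H for @conj_scalar R k}).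
Hypothesis ip_norm : forall x : H, `|x| ^+ 2 = ip x x.

Lemma ip_eq0C x y : ip x y = 0 -> ip y x = 0.
Proof.
have herm : ip y x = (-1) ^+ false * conj_scalar (ip x y).
  exact: (@hermitian_subproof _ _ _ _ ip y x).
by move=> xy; rewrite herm xy conj_scalar0 mulr0.
Qed.

Lemma pythagoras x y : ip x y = 0 -> `|x + y| ^+ 2 = `|x| ^+ 2 + `|y| ^+ 2.
Proof.
move=> xy; rewrite !ip_norm linearDl !linearDr /=.
by rewrite xy (ip_eq0C xy) addr0 add0r.
Qed.

(** [c *: y] is the orthogonal projection of [x] onto the line through [y]; by Pythagoras it is no
    longer than [x]. *)
Lemma cauchy_schwarz x y : `|ip x y| <= `|x| * `|y|.
Proof.
have [->|y0] := eqVneq y 0; first by rewrite linear0r !normr0 mulr0.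
have ny : 0 < `|y| by rewrite normr_gt0.
pose c := ip x y / `|y| ^+ 2.
have xcy : ip (x - c *: y) (c *: y) = 0.
  rewrite linearZr_LR /= linearBl linearZl_LR /= -ip_norm /c divfK ?subrr ?mulr0 //.
  by rewrite expf_neq0 // lt0r_neq0.
have := pythagoras xcy; rewrite subrK => xE.
have : `|c *: y| ^+ 2 <= `|x| ^+ 2 by rewrite xE lerDr exprn_ge0.
have -> : `|c *: y| = `|ip x y| / `|y|.
  rewrite normrZ /c normrM normfV normrX normr_id.
  by rewrite expr2 invfM mulrA divfK ?lt0r_neq0.
by rewrite ler_pXn2r ?nnegrE ?divr_ge0 // ler_pdivrMr.
Qed.

Lemma ip_inj x y : (forall z, ip x z = ip y z) -> x = y.
Proof.
move=> xy; apply/eqP; rewrite -subr_eq0 -normr_eq0 -sqrf_eq0 ip_norm.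
by rewrite linearBl /= xy subrr.
Qed.

Lemma pythagoras_sum (I : finType) (v : I -> H) :
  (forall i j, i != j -> ip (v i) (v j) = 0) ->
  `|\sum_i v i| ^+ 2 = \sum_i `|v i| ^+ 2.
Proof.
move=> orth.
suff : forall s : seq I, uniq s ->
    `|\sum_(i <- s) v i| ^+ 2 = \sum_(i <- s) `|v i| ^+ 2.
  by apply; exact: index_enum_uniq.
elim=> [|i s IHs] /=; first by rewrite !big_nil normr0 expr0n.
move=> /andP[iNs us]; rewrite !big_cons pythagoras ?IHs //.
rewrite linear_sumr big_seq big1 // => j js; apply: orth.
by apply: contraNneq iNs => ->.
Qed.

(** * Finite resolutions of the identity and their step operators *)

Record resolution_of_identity (I : finType) (P : I -> H -> H) : Prop := {
  roi_linear : forall i, linear (P i) ;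
  roi_self_adjoint : forall i, self_adjoint ip (P i) ;
  roi_orthogonal : forall i j x, P i (P j x) = if i == j then P i x else 0 ;
  roi_sum : forall x, \sum_i P i x = x }.

Definition step_operator (I : finType) (P : I -> H -> H) (c : I -> F) (x : H) : H :=
  \sum_i c i *: P i x.

Section Resolution.
Variables (I : finType) (P : I -> H -> H).
Hypothesis Pres : resolution_of_identity P.

(** Moving [P i] across the inner product produces [P i (P j x)], which vanishes for distinct
    indices, so the summands are orthogonal. *)
Lemma roi_norm_sum (c : I -> F) x :
  `|step_operator P c x| ^+ 2 = \sum_i `|c i| ^+ 2 * `|P i x| ^+ 2.
Proof.
rewrite pythagoras_sum => [|i j ij].
  by apply: eq_bigr => i _; rewrite normrZ exprMn.
rewrite linearZl_LR linearZr_LR /= (roi_self_adjoint Pres) (roi_orthogonal Pres).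
by rewrite (negbTE ij) linear0r !mulr0.
Qed.

(** With all coefficients 1, [roi_norm_sum] expresses [|x| ^+ 2] through the [|P i x| ^+ 2]; the two
    sums are then compared termwise. Bounding [c i] only where [P i x != 0] later discards empty
    intersections of cells. *)
Lemma norm_step_operator (c : I -> F) M x : 0 <= M ->
  (forall i, P i x != 0 -> `|c i| <= M) -> `|step_operator P c x| <= M * `|x|.
Proof.
move=> M0 cM; rewrite -(@ler_pXn2r _ 2) ?nnegrE ?mulr_ge0 //.
have xE : \sum_i (fun=> 1) i *: P i x = x.
  by rewrite -[RHS](roi_sum Pres); apply: eq_bigr => i _; rewrite scale1r.
rewrite roi_norm_sum exprMn -[in leRHS]xE roi_norm_sum mulr_sumr.
apply: ler_sum => i _; rewrite normr1 expr1n mul1r.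
have [->|Pi0] := eqVneq (P i x) 0; first by rewrite normr0 expr0n !mulr0.
by rewrite ler_wpM2r ?exprn_ge0 // ler_pXn2r ?nnegrE // cM.
Qed.

(** The [P i] diagonalise the step operator, which is why step operators multiply
    coefficientwise. *)
Lemma roi_step_operator (c : I -> F) x i :
  P i (step_operator P c x) = c i *: P i x.
Proof.
have Padd := roi_linear Pres i.
have P0 : P i 0 = 0.
  by have := Padd (-1) 0 0; rewrite scaler0 addr0 scaleN1r addNr.
have Psum (s : seq I) (v : I -> H) :
    P i (\sum_(j <- s) v j) = \sum_(j <- s) P i (v j).
  elim: s => [|j s IHs]; first by rewrite !big_nil.
  by rewrite !big_cons -[v j]scale1r Padd IHs !scale1r.
have PZ a v : P i (a *: v) = a *: P i v by rewrite -[a *: v]addr0 Padd P0 addr0.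
rewrite Psum (bigD1 i) //= PZ (roi_orthogonal Pres) eqxx big1 ?addr0 // => j ji.
by rewrite PZ (roi_orthogonal Pres) eq_sym (negbTE ji) scaler0.
Qed.

Lemma step_operatorM (c d : I -> F) x :
  step_operator P (fun i => c i * d i) x
  = step_operator P c (step_operator P d x).
Proof. by apply: eq_bigr => i _; rewrite roi_step_operator scalerA. Qed.

Lemma step_operatorP a (c d : I -> F) x :
  step_operator P (fun i => a * c i + d i) x
  = a *: step_operator P c x + step_operator P d x.
Proof.
rewrite /step_operator scaler_sumr -big_split; apply: eq_bigr => i _.
by rewrite scalerDl scalerA.
Qed.

End Resolution.
End InnerProduct.

(** * Weierstrass approximation *)

Section Bernstein.
Variable F : numFieldType.

(* The n-th Bernstein polynomial of the function [i/n |-> phi i], by de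
   Casteljau's recursion. *)
Fixpoint bernstein (n : nat) (phi : nat -> F) (x : F) : F :=
  if n is m.+1 then
    x * bernstein m (fun i => phi i.+1) x + (1 - x) * bernstein m phi x
  else phi 0%N.

(** The weights [x] and [1 - x] of the recursion sum to 1, so an additive constant passes through
    unchanged. *)
Lemma bernstein_affine n a b c (phi psi : nat -> F) x :
  bernstein n (fun i => a * phi i + b * psi i + c) x
  = a * bernstein n phi x + b * bernstein n psi x + c.
Proof.
elim: n phi psi => [//|n IHn] phi psi /=.
rewrite (IHn (fun i => phi i.+1) (fun i => psi i.+1)) IHn; ring.
Qed.

(** For [x] in the unit interval this is the second moment about [c] of a binomial variable with
    mean [n x] and variance [n x (1 - x)]. A general [c] lets the induction absorb the shift from
    [i] to [i.+1]. *)
Lemma bernstein_variance n c x :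
  bernstein n (fun i => (i%:R - c) ^+ 2) x = (n%:R * x - c) ^+ 2 + n%:R * x * (1 - x).
Proof.
elim: n c => [|n IHn] c /=; first by ring.
have -> : (fun i : nat => (i.+1%:R - c) ^+ 2) = (fun i => (i%:R - (c - 1)) ^+ 2).
  by apply/funext => i; rewrite -natr1; ring.
rewrite !IHn -natr1; ring.
Qed.

Lemma norm_bernstein n (phi psi : nat -> F) x : 0 <= x <= 1 ->
  (forall i, `|phi i| <= psi i) -> `|bernstein n phi x| <= bernstein n psi x.
Proof.
move=> /andP[x0 x1]; elim: n phi psi => [|n IHn] phi psi phipsi /=; first exact: phipsi.
apply: (le_trans (ler_normD _ _)); rewrite !normrM (ger0_norm x0).
rewrite (@ger0_norm _ (1 - x)) ?subr_ge0 //.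
by rewrite lerD // ler_wpM2l ?subr_ge0 // IHn.
Qed.

(** Chebyshev's argument: averaging turns the quadratic term into [C * x * (1 - x) / n], by the
    variance formula. *)
Lemma bernstein_approx n (phi : nat -> F) x y e C : (0 < n)%N -> 0 <= x <= 1 ->
  0 <= C ->
  (forall i, `|phi i - y| <= e + C * (i%:R - n%:R * x) ^+ 2 / n%:R ^+ 2) ->
  `|bernstein n phi x - y| <= e + C / n%:R.
Proof.
move=> n0 x01 C0 phiy; have /andP[x0 x1] := x01.
have nR : 0 < n%:R :> F by rewrite ltr0n.
pose sq := fun i : nat => (i%:R - n%:R * x) ^+ 2.
have -> : bernstein n phi x - y = bernstein n (fun i => phi i - y) x.
  have -> : (fun i => phi i - y) = (fun i => 1 * phi i + 0 * phi i + - y).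
    by apply/funext => i; ring.
  by rewrite bernstein_affine; ring.
(* The summand [0 * sq i] only gives the majorant the shape required by [bernstein_affine]. *)
apply: (le_trans (norm_bernstein (psi := fun i => (C / n%:R ^+ 2) * sq i + 0 * sq i + e) _ x01 _)).
  move=> i; rewrite (le_trans (phiy i)) // le_eqVlt; apply/orP; left; apply/eqP.
  rewrite /sq; ring.
rewrite bernstein_affine bernstein_variance subrr mul0r addr0 expr0n add0r addrC lerD2l.
have -> : C / n%:R ^+ 2 * (n%:R * x * (1 - x)) = C / n%:R * (x * (1 - x)).
  by field; rewrite lt0r_neq0.
rewrite -[leRHS]mulr1 ler_wpM2l ?divr_ge0 ?(ltW nR) //.
by rewrite mulr_ile1 ?subr_ge0 // gerBl.
Qed.

End Bernstein.

(** In the near-covering form of compactness it suffices to treat all [u] near one point [x] and all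
    small [d], where [f u] and [f v] are compared through [f x]. *)
Lemma compact_uniform_continuity (R : realType) (F : numFieldType) (K : set R)
    (f : R -> F) (e : F) : compact K -> {within K, continuous f} -> 0 < e ->
  exists2 d : R, 0 < d & forall u v, K u -> K v -> `|u - v| < d -> `|f u - f v| < e.
Proof.
move=> Kc /subspace_continuousP fc e0.
have := (compact_near_coveringP K).1 Kc => /near_covering_withinP.
move=> /(_ R (0^'+) (fun d u => forall v, K v -> `|u - v| < d -> `|f u - f v| < e) _).
case.
  move=> x Kx; have := fc x Kx => /cvgrPdist_lt /(_ (e / 2)).
  rewrite divr_gt0 // => /(_ isT).
  rewrite near_withinE near_simpl => /nbhs_ballP[r /= r0 xr].
  (* With [u] within [r / 2] of [x] and [v] within [r / 2] of [u], both lie in the ball of radius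
     [r] about [x]. *)
  exists (ball x (r / 2), [set d | d < r / 2]) => /=.
    split; first by apply: nbhsx_ballx; rewrite divr_gt0.
    by apply: nbhs_right_lt; rewrite divr_gt0.
  move=> [u d] /= [xu dr] Ku v Kv uv.
  rewrite -(subrK (f x) (f u)) -addrA (le_lt_trans (ler_normD _ _)) //.
  rewrite (splitr e) ltrD //.
    rewrite distrC; apply: xr => //=.
    by apply: le_ball xu; rewrite ler_pdivrMr // ler_peMr ?ltW // ltr1n.
  apply: xr => //=; rewrite /ball /= -(subrK u x) -addrA.
  rewrite (le_lt_trans (ler_normD _ _)) // (splitr r) ltrD //.
  exact: lt_trans uv dr.
move=> r /= r0 rP; exists (r / 2); first by rewrite divr_gt0.
move=> u v Ku Kv uv; apply: (rP (r / 2)) => //=; last by rewrite divr_gt0.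
rewrite distrC subr0 gtr0_norm ?divr_gt0 //.
by rewrite ltr_pdivrMr // ltr_pMr // ltr1n.
Qed.

(* An f that is only continuous on K is extended to the line as [f \o c], where
   [c s] is an almost nearest point of K: [c s] is within [3 * |s - x|] of any
   x in K. *)
Lemma near_projection (R : realType) (K : set R) : closed K ->
  forall s : R, exists c, forall x, K x -> K c /\ `|c - s| <= 2 * `|x - s|.
Proof.
move=> Kc s.
have [Ks|nKs] := pselect (K s).
  by exists s => x Kx; rewrite subrr normr0 mulr_ge0.
have [K0|/set0P[x0 Kx0]] := eqVneq K set0; first by exists 0 => x; rewrite K0.
have : open (~` K) by rewrite openC.
rewrite openE => /(_ s nKs) /nbhs_ballP[r /= r0 rK].
have far x : K x -> r <= `|x - s|.
  move=> Kx; rewrite leNgt; apply/negP => xs; apply: (rK x) => //.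
  by rewrite /ball /= distrC.
pose D := [set `|x - s| | x in K].
have Dinf : has_inf D.
  by split; [exists `|x0 - s|, x0 | exists r => _ [x Kx <-]; exact: far].
have rD : r <= inf D by apply: lb_le_inf; [exists `|x0 - s|, x0|move=> _ [x Kx <-]; exact: far].
have [_ [c Kcc <-] cD] := inf_adherent (lt_le_trans r0 rD) Dinf.
exists c => x Kx; split=> //; rewrite (le_trans (ltW cD)) //.
rewrite -mulr2n -[inf D *+ 2]mulr_natl ler_wpM2l // ge_inf //; first exact: Dinf.2.
by exists x.
Qed.

Section Weierstrass.
Variables (R : realType) (k : scalar_kind).
Local Notation F := (scalars R k).
Local Notation iota := (@of_real R k).
Variable S : (R -> F) -> Prop.
Hypothesis S_const : forall c, S (fun=> c).
Hypothesis S_id : S iota.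
Hypothesis S_lin : forall a f g, S f -> S g -> S (fun t => a * f t + g t).
Hypothesis S_mul : forall f g, S f -> S g -> S (fun t => f t * g t).

Lemma bernstein_closed n (phi : nat -> F) u : S u -> S (fun t => bernstein n phi (u t)).
Proof.
move=> Su; elim: n phi => [|n IHn] phi /=; first exact: S_const.
(* The recursion is rewritten with combinations [a * f + g], the only sums under which [S] is known
   to be closed. *)
have -> : (fun t => u t * bernstein n (fun i => phi i.+1) (u t)
                    + (1 - u t) * bernstein n phi (u t)) =
    (fun t => 1 * (u t * bernstein n (fun i => phi i.+1) (u t))
       + (- 1 * u t + 1) * bernstein n phi (u t)).
  by apply/funext => t; ring.
apply: S_lin; first exact: S_mul.
by apply: S_mul => //; apply: S_lin => //; exact: S_const.
Qed.

(** Bernstein's proof, with [S] in the role of the polynomials. Samples of [f] taken near [t] are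
    within [e / 2] of [f t] by uniform continuity; the others are off by at most [2 * M], which the
    quadratic term of [bernstein_approx] dominates. *)
Lemma weierstrass (K : set R) (f : R -> F) (M e : F) :
  compact K -> {within K, continuous f} -> (forall t, K t -> `|f t| <= M) ->
  0 < e -> exists2 g, S g & forall t, K t -> `|f t - g t| <= e.
Proof.
move=> Kcpt fc fM e0.
have [K0|/set0P[x0 Kx0]] := eqVneq K set0.
  by exists (fun=> 0) => [|t]; [exact: S_const | rewrite K0].
have M0 : 0 <= M by rewrite (le_trans _ (fM _ Kx0)).
have [r r0 re] := gt0_of_real e0.
have [m m0 mM] := ge0_of_real M0.
have e20 : 0 < e / 2 by rewrite divr_gt0.
have [d d0 fd] := compact_uniform_continuity Kcpt fc e20.
have Kcl : closed K by apply: compact_closed => //; exact: Rhausdorff.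
have /choice[kap kapP] := near_projection Kcl.
have [L [_ KL]] := compact_bounded Kcpt.
have {KL} KL t : K t -> `|t| <= `|L| + 1.
  by move=> Kt; apply: KL => //; rewrite (le_lt_trans (ler_norm _)) // ltrDl.
move: KL; set B := `|L| + 1 => KL.
have B0 : 0 < B by rewrite ltr_wpDl.
pose u t := (t + B) / (2 * B).
have u01 t : K t -> 0 <= u t <= 1.
  move=> /KL; rewrite ler_norml => /andP[t1 t2].
  have B20 : 0 < 2 * B by rewrite mulr_gt0.
  rewrite /u ler_pdivrMr // ler_pdivlMr //; lra.
(* As [i - n * u t = n * (s - t) / (2 * B)] for the node [s] of index [i], this [C] turns the
   quadratic term into [18 * m * (|t - s| / d) ^+ 2], which is at least [2 * m] once
   [d <= 3 * |t - s|]. *)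
pose C := 72 * m * B ^+ 2 / d ^+ 2.
have C0 : 0 <= C by rewrite divr_ge0 ?mulr_ge0 ?exprn_ge0 // ltW.
pose n := (Num.truncn (2 * C / r)).+1.
have n0 : 0 < n%:R :> R by rewrite ltr0n.
have Cn : C / n%:R <= r / 2.
  rewrite ler_pdivrMr // mulrAC ler_pdivlMr // mulrC.
  by rewrite -ler_pdivrMl // mulrC (mulrC C) (mulrC r^-1) ltW // /n truncnS_gt.
(* The argument of [kap] is the point that [u] maps to [i / n]; it may lie outside [K]. *)
pose phi i := f (kap (i%:R / n%:R * (2 * B) - B)).
exists (fun t => bernstein n phi (iota (u t))).
  apply: bernstein_closed.
  have -> : (fun t => iota (u t)) =
      (fun t => iota (2 * B)^-1 * iota t + iota (B / (2 * B))).
    by apply/funext => t; rewrite -rmorphM -rmorphD /u; congr (iota _); ring.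
  exact: S_lin.
move=> t Kt; rewrite distrC.
have ut := u01 t Kt.
have -> : e = e / 2 + e / 2 by rewrite -splitr.
apply: (@le_trans _ _ (e / 2 + iota C / n%:R)); last first.
  rewrite lerD2l re -(rmorph_nat iota) -(rmorph_nat iota 2) -!fmorphV -!rmorphM.
  by rewrite ler_of_real.
apply: bernstein_approx => //.
- by rewrite -(rmorph0 iota) -(rmorph1 iota) !ler_of_real.
- by rewrite -(rmorph0 iota) ler_of_real.
move=> i; set s := i%:R / n%:R * (2 * B) - B.
have [Kks ks] := kapP s t Kt.
have us : i%:R - n%:R * u t = n%:R * (s - t) / (2 * B).
  by rewrite /u /s; field; rewrite !lt0r_neq0.
have -> : iota C * (i%:R - n%:R * iota (u t)) ^+ 2 / n%:R ^+ 2 =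
    iota (18 * m * (`|t - s| / d) ^+ 2).
  rewrite -!(rmorph_nat iota) -rmorphM -rmorphB -!rmorphXn -fmorphV -!rmorphM /=.
  congr (iota _); rewrite us [(_ / d) ^+ 2]expr_div_n real_normK ?num_real //.
  by rewrite /C; field; rewrite !lt0r_neq0.
have [close|far] := ltP `|kap s - t| d.
  rewrite (le_trans (ltW (fd _ _ Kks Kt close))) // lerDl -(rmorph0 iota) ler_of_real.
  by rewrite mulr_ge0 ?exprn_ge0 ?mulr_ge0 ?invr_ge0 ?(ltW d0).
have fff : `|f (kap s) - f t| <= M + M.
  by rewrite (le_trans (ler_normB _ _)) // lerD ?fM.
rewrite /phi -/s (le_trans fff) // -[leLHS]add0r lerD ?(ltW e20) //.
rewrite mM -rmorphD ler_of_real.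
(* Since [kap s] is within [2 * |t - s|] of [s], a sample point far from [t] forces the node itself
   to be far from [t]. *)
have h3 : d <= 3 * `|t - s|.
  rewrite (le_trans far) // -(subrK s (kap s)) -addrA (le_trans (ler_normD _ _)) //.
  by rewrite (distrC s); lra.
have : 1 <= (3 * (`|t - s| / d)) ^+ 2.
  by rewrite exprn_ege1 // mulrA ler_pdivlMr ?mul1r.
rewrite exprMn => h; have := ler_wpM2l m0 h; lra.
Qed.

End Weierstrass.

(** * Cousin's lemma *)

Section Cousin.
Variables (R : realType) (K : set R) (g : R -> R) (a : R).

Definition half_open_cell (p : seq R) (i : nat) : set R :=
  K `&` [set` `[p`_i, p`_i.+1[].

(* With half-open cells, the tag of a new last cell [c, d[ can be any point of
   [c, d[; the supremum argument below needs the tag to be the supremum. *)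
Record partial_partition (c : R) (p : seq R) (n : nat) (C : nat -> set R)
    (t : nat -> R) : Prop := {
  pp_sorted : sorted <%R (a :: p) ;
  pp_last : last a p = c ;
  pp_cell : forall j, (j < n)%N ->
    exists2 i, (i < size p)%N & C j = half_open_cell (a :: p) i ;
  pp_cover : forall s, (exists2 j, (j < n)%N & C j s) <-> K s /\ a <= s < c ;
  pp_disjoint : forall i j s, (i < n)%N -> (j < n)%N -> C i s -> C j s -> i = j ;
  pp_tag : forall j, (j < n)%N -> C j (t j) ;
  pp_fine : forall j, (j < n)%N ->
    C j `<=` [set` `]t j - g (t j), t j + g (t j)[] }.

Definition partitionable c := exists p n C t, partial_partition c p n C t.

Lemma partitionable_start : partitionable a.
Proof.
exists [::], 0%N, (fun=> set0), (fun=> 0); split=> //= s.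
by split=> [[] //|[_ /andP[sa /(le_lt_trans sa)]]]; rewrite ltxx.
Qed.

Lemma sorted_rcons_last p c d : sorted <%R (a :: p) -> last a p = c -> c < d ->
  sorted <%R (a :: rcons p d).
Proof. by move=> /= sp lp cd; rewrite rcons_path sp lp. Qed.

Lemma half_open_cell_rcons p d i : (i < size p)%N ->
  half_open_cell (a :: rcons p d) i = half_open_cell (a :: p) i.
Proof.
move=> ip; rewrite /half_open_cell -rcons_cons !nth_rcons /= !ltnS ip.
by rewrite (ltnW ip).
Qed.

Lemma le_start c p : sorted <%R (a :: p) -> last a p = c -> a <= c.
Proof.
move=> /= sp <-; have [->//|pn0] := eqVneq p [::].
have := @order_path_min _ _ _ _ lt_trans sp => /allP ap.
by rewrite ltW // ap // -[last a p]/(last a p) (last_nth a) /=; case: p pn0 {sp ap} => //= *; rewrite mem_nth.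
Qed.

(** The division gains the point [d], but no cell is added, since [K] does not meet the new
    interval. *)
Lemma partitionable_gap c d : partitionable c -> c < d ->
  (forall s, K s -> ~~ (c <= s < d)) -> partitionable d.
Proof.
move=> [p [n [C [t [sp lp cell cover disj tag fine]]]]] cd gap.
have ac := le_start sp lp.
exists (rcons p d), n, C, t; split=> //.
- exact: sorted_rcons_last sp lp cd.
- by rewrite last_rcons.
- move=> j /cell[i ip ->]; exists i; first by rewrite size_rcons leqW.
  by rewrite half_open_cell_rcons.
move=> s; rewrite cover; split=> -[Ks /andP[as_ sd]]; split=> //.
  by rewrite as_ (lt_trans sd).
rewrite as_ /=; have := gap s Ks; rewrite sd andbT -ltNge; exact.
Qed.

(** One cell over [[c, d[] is added with tag [x]; the last two inequalities say that the gauge at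
    [x] covers it. *)
Lemma partitionable_step c d x : partitionable c -> c < d ->
  K x -> c <= x < d -> x - g x < c -> d <= x + g x -> partitionable d.
Proof.
move=> [p [n [C [t [sp lp cell cover disj tag fine]]]]] cd Kx xcd gc gd.
have ac := le_start sp lp.
pose D := K `&` [set` `[c, d[].
(* In [a :: rcons p d] the entries at [size p] and [(size p).+1] are [c] and [d]. *)
have Dlast : D = half_open_cell (a :: rcons p d) (size p).
  rewrite /D /half_open_cell -rcons_cons !nth_rcons /= !ltnS leqnn ltnn eqxx.
  by rewrite -lp (last_nth 0).
have CD j s : (j < n)%N -> C j s -> D s -> False.
  move=> jn Cs [_ /=]; rewrite in_itv /= => /andP[cs _].
  have [_ /andP[_]] := (cover s).1 (ex_intro2 _ _ j jn Cs).
  by move=> /(le_lt_trans cs); rewrite ltxx.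
exists (rcons p d), n.+1, (fun j => if (j < n)%N then C j else D),
  (fun j => if (j < n)%N then t j else x); split.
- exact: sorted_rcons_last sp lp cd.
- by rewrite last_rcons.
- move=> j jn; case: ifP => [/cell[i ip ->]|_].
    exists i; first by rewrite size_rcons leqW.
    by rewrite half_open_cell_rcons.
  by exists (size p); rewrite ?size_rcons.
- move=> s; split=> [[j jn]|[Ks /andP[as_ sd]]].
    case: ifP => [jn' Cs|_ [Ks /=]].
      have [Ks /andP[as_ sc]] := (cover s).1 (ex_intro2 _ _ j jn' Cs).
      by split=> //; rewrite as_ (lt_trans sc).
    by rewrite in_itv /= => /andP[cs ->]; split=> //; rewrite (le_trans ac).
  have [sc|cs] := ltP s c.
    have [j jn Cs] := (cover s).2 (conj Ks (introT andP (conj as_ sc))).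
    by exists j; rewrite ?ltnS ?(ltnW jn) // jn.
  by exists n => //; rewrite ltnn; split=> //=; rewrite in_itv /= cs sd.
- move=> i j s; rewrite !ltnS => ni nj; case: ifP => iltn; case: ifP => jltn.
  + exact: disj.
  + by move=> Ci Ds; case: (CD i s).
  + by move=> Ds Cj; case: (CD j s).
  + move=> _ _; transitivity n; first by apply/eqP; rewrite eqn_leq ni leqNgt iltn.
    by apply/eqP; rewrite eqn_leq nj leqNgt jltn.
- move=> j jn; case: ifP => [/tag //|_]; split=> //=; by rewrite in_itv.
- move=> j jn; case: ifP => [/fine //|_] s [_ /=]; rewrite !in_itv /=.
  by move=> /andP[cs sd]; rewrite (lt_le_trans gc cs) (lt_le_trans sd gd).
Qed.

Hypotheses (Kcl : closed K) (g_gauge : gauge K g).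

(** Otherwise the partitionable points have a supremum [s]. If [s] is in [K], a cell tagged [s]
    reaches beyond it; if not, closedness gives a gap around [s]. Either way some point beyond [s]
    is partitionable. *)
Lemma partitionable_unbounded b : exists2 c, b < c & partitionable c.
Proof.
apply: contrapT => nP.
have ub c : partitionable c -> c <= b.
  by move=> Pc; rewrite leNgt; apply/negP => bc; apply: nP; exists c.
have Psup : has_sup partitionable.
  by split; [exists a; exact: partitionable_start | exists b].
pose s := sup partitionable.
have [e e0 He] : exists2 e, 0 < e & forall c, s - e < c -> c <= s ->
    partitionable c -> partitionable (s + e / 2).
  have [Ks|nKs] := pselect (K s).
    exists (g s); first exact: g_gauge.
    have gs := g_gauge Ks.
    move=> c sc cs Pc; apply: (partitionable_step Pc _ Ks); lra.
  have : open (~` K) by rewrite openC.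
  rewrite openE => /(_ s nKs) /nbhs_ballP[e /= e0 eK].
  exists e => // c sc cs Pc; apply: (partitionable_gap Pc); first lra.
  move=> x Kx; apply/negP => /andP[cx xs]; apply: (eK x) => //.
  rewrite /ball /= ltr_norml; lra.
have [c Pc sc] := sup_adherent e0 Psup.
have cs : c <= s by apply: sup_upper_bound.
have := sup_upper_bound Psup (He c sc cs Pc); rewrite -/s; lra.
Qed.

End Cousin.

Lemma cousin (R : realType) (K : set R) (g : R -> R) (M : R) :
  closed K -> (forall x, K x -> `|x| <= M) -> gauge K g ->
  exists n (C : 'I_n -> set R) t, tagged_partition K C t /\ gauge_fine K g C t.
Proof.
move=> Kcl KM gg; pose a := - M - 1.
(* The choice of [a] puts the first division point strictly below [K]. Going past [M] puts the last
   one above [K], and going past [a] guarantees at least two points, even for empty [K]. *)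
have [c Mc [p [n [C [t [sp lp cell cover disj tag fine]]]]]] :=
  partitionable_unbounded a Kcl gg (Num.max M a).
move: Mc; rewrite gt_max => /andP[Mc ac].
have cellK j : (j < n)%N -> C j `<=` K by move=> /cell[i _ ->] s [].
have Kac x : K x -> a < x < c by move=> /KM; rewrite ler_norml /a; lra.
exists n, (fun j => C j), (fun j => t j); split; last first.
  by move=> j s Cs; split; [exact: fine Cs | exact: cellK Cs].
split.
- exists (a :: p).
    split=> //.
      by case: p lp {sp cell} => //= ac'; move: ac; rewrite ac' ltxx.
    by move=> s Ks /=; rewrite -(last_nth 0 a) lp; exact: Kac.
  move=> j; have [i ip ->] := cell j (ltn_ord j).
  (* The two values [true] encode a closed left end and an open right end. *)
  by exists i, true, true; split.
- apply/seteqP; split=> [s [j _]|s Ks]; first exact: cellK.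
  have [j jn Cs] : exists2 j, (j < n)%N & C j s.
    by apply/cover; split=> //; have /andP[/ltW-> ->] := Kac s Ks.
  by exists (Ordinal jn).
- by move=> i j _ _ [s [Ci Cj]]; apply/val_inj; exact: disj Ci Cj.
- by move=> j; exact: tag.
Qed.

(** * Step operators of a projection-valued measure *)

Lemma split_thirds (F : numFieldType) (e : F) : e = e / 3%:R + (e / 3%:R + e / 3%:R).
Proof. by field. Qed.

(** * Common refinement of two commuting resolutions of the identity *)

Section CommonRefinement.
Variables (R : realType) (k : scalar_kind).
Local Notation F := (scalars R k).
Variables (H : normedModType F) (ip : {dot H for @conj_scalar R k}).
Hypothesis ip_norm : forall x : H, `|x| ^+ 2 = ip x x.
Variables (I J : finType) (P : I -> H -> H) (Q : J -> H -> H).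
Hypotheses (Pres : resolution_of_identity ip P) (Qres : resolution_of_identity ip Q).
Hypothesis PQ : forall i j x, P i (Q j x) = Q j (P i x).

Let PQprod (ij : I * J) (x : H) := P ij.1 (Q ij.2 x).

Lemma step_operator_fst (c : I -> F) x :
  step_operator PQprod (fun ij => c ij.1) x = step_operator P c x.
Proof.
rewrite /step_operator /PQprod -(pair_bigA _ (fun i j => c i *: P i (Q j x))) /=.
apply: eq_bigr => i _; rewrite -scaler_sumr -[in RHS](roi_sum Qres (P i x)).
by congr (_ *: _); apply: eq_bigr => j _.
Qed.

Lemma step_operator_snd (d : J -> F) x :
  step_operator PQprod (fun ij => d ij.2) x = step_operator Q d x.
Proof.
rewrite /step_operator /PQprod -(pair_bigA _ (fun i j => d j *: P i (Q j x))) /=.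
by rewrite exchange_big; apply: eq_bigr => j _; rewrite -scaler_sumr (roi_sum Pres).
Qed.

(** Commutation makes the products self-adjoint and lets the orthogonality relations of the two
    families be applied separately. *)
Lemma roi_product : resolution_of_identity ip PQprod.
Proof.
split.
- by move=> [i j] a x y; rewrite /PQprod /= (roi_linear Qres) (roi_linear Pres).
- move=> [i j] x y.
  by rewrite /PQprod /= (roi_self_adjoint Pres) (roi_self_adjoint Qres) PQ.
- move=> [i j] [i' j'] x; rewrite /PQprod /= -PQ (roi_orthogonal Pres) (roi_orthogonal Qres).
  rewrite xpair_eqE; case: eqP => [->|_] //=; case: eqP => // _.
  by have := roi_linear Pres i' (-1) 0 0; rewrite scaler0 addr0 scaleN1r addNr.
- move=> x; rewrite -[RHS](roi_sum Qres).
  have := step_operator_snd (fun=> 1) x; rewrite /step_operator.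
  under eq_bigr do rewrite scale1r; move=> ->.
  by under eq_bigr do rewrite scale1r.
Qed.

(** Over the common refinement the difference is again a step operator, with coefficients
    [c i - d j]. *)
Lemma norm_step_operatorB (c : I -> F) (d : J -> F) M x : 0 <= M ->
  (forall i j, P i (Q j x) != 0 -> `|c i - d j| <= M) ->
  `|step_operator P c x - step_operator Q d x| <= M * `|x|.
Proof.
move=> M0 cdM; rewrite -step_operator_fst -step_operator_snd.
have -> : step_operator PQprod (fun ij => c ij.1) x
          - step_operator PQprod (fun ij => d ij.2) x
        = step_operator PQprod (fun ij => c ij.1 - d ij.2) x.
  by rewrite /step_operator -sumrB; apply: eq_bigr => ij _; rewrite scalerBl.
apply: norm_step_operator => //; first exact: roi_product.
by move=> [i j]; exact: cdM.
Qed.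

End CommonRefinement.

(** The cells need not be intervals and the gauge is a constant mesh: this is all that the
    operator-norm estimates use. *)
Record fine_borel_partition (R : realType) (K : set R) (d : R) (n : nat)
    (C : 'I_n -> set R) (t : 'I_n -> R) : Prop := {
  fbp_borel : forall j, borel_subset K (C j) ;
  fbp_trivIset : trivIset setT C ;
  fbp_cover : \bigcup_j C j = K ;
  fbp_tag : forall j, C j (t j) ;
  fbp_fine : forall j s, C j s -> `|s - t j| < d }.

Section SpectralMeasure.
Variables (R : realType) (k : scalar_kind).
Local Notation F := (scalars R k).
Local Notation iota := (@of_real R k).
Variables (H : normedModType F) (ip : {dot H for @conj_scalar R k}).
Hypothesis ip_norm : forall x : H, `|x| ^+ 2 = ip x x.
Variables (K : set R) (E : set R -> H -> H).
Hypothesis E_pvm : projection_valued_measure ip K E.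

Lemma borel_subset0 : borel_subset K set0.
Proof. by split=> //; exact: measurable0. Qed.

(** Padding the family with empty sets makes countable additivity applicable, and the partial sums
    are eventually constant. *)
Lemma pvm_finite_sum n (C : 'I_n -> set R) x : (forall j, borel_subset K (C j)) ->
  trivIset setT C -> \bigcup_j C j = K -> \sum_j E (C j) x = x.
Proof.
move=> Cb Ct CK; pose B i := if insub i is Some j then C j else set0.
have Bval j : B (val j) = C j by rewrite /B valK.
have Bb i : borel_subset K (B i).
  by rewrite /B; case: insub => [j|]; [exact: Cb | exact: borel_subset0].
have Bt : trivIset setT B.
  move=> i j _ _ [s []]; rewrite /B.
  case: insubP => // i' _ <- Ci; case: insubP => // j' _ <- Cj; congr val.
  by apply: Ct => //; exists s.
have BK : \bigcup_i B i = K.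
  rewrite -CK; apply/seteqP; split=> s.
    by move=> [i _]; rewrite /B; case: insub => // j Cj; exists j.
  by move=> [j _ Cj]; exists (val j) => //; rewrite Bval.
have := @pvm_bigcup _ _ _ _ _ _ E_pvm B Bb Bt x; rewrite BK (pvm_full E_pvm) => Ex.
apply: (cvg_unique (@norm_hausdorff _ _) _ Ex).
apply: cvg_near_cst; exists n => // N /= nN.
rewrite -(big_mkord xpredT (fun i => E (B i) x)) (big_cat_nat _ nN) //=.
rewrite [X in _ + X]big1_seq ?addr0; last first.
  move=> i /=; rewrite mem_index_iota => /andP[ni _].
  by rewrite /B insubF ?(pvm_set0 E_pvm) // ltnNge ni.
by rewrite big_mkord; apply: eq_bigr => j _; rewrite Bval.
Qed.

Lemma pvm_resolution n (C : 'I_n -> set R) : (forall j, borel_subset K (C j)) ->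
  trivIset setT C -> \bigcup_j C j = K ->
  resolution_of_identity ip (fun j => E (C j)).
Proof.
move=> Cb Ct CK; split.
- by move=> j; case: (pvm_bounded E_pvm (Cb j)).
- by move=> j; exact: (pvm_self_adjoint E_pvm).
- move=> i j x; rewrite -(pvm_setI E_pvm) //.
  have [->|ij] := eqVneq i j; first by rewrite setIid.
  by have /trivIsetP/(_ i j I I ij) -> := Ct; rewrite (pvm_set0 E_pvm).
- by move=> x; exact: pvm_finite_sum.
Qed.

Lemma pvm_commute B C x : borel_subset K B -> borel_subset K C ->
  E B (E C x) = E C (E B x).
Proof. by move=> bB bC; rewrite -!(pvm_setI E_pvm) // setIC. Qed.

(** A Riemann-type integral: [T] is the operator-norm limit of the tagged step operators of [g] as
    the mesh tends to 0. The mesh [d] is chosen before [x]. *)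
Definition approximable (T : H -> H) (g : R -> F) : Prop :=
  forall e : F, 0 < e -> exists2 d : R, 0 < d &
    forall n (C : 'I_n -> set R) t, fine_borel_partition K d C t ->
    forall x, `|T x - step_operator (fun j => E (C j)) (g \o t) x| <= e * `|x|.

Lemma fbp_resolution d n (C : 'I_n -> set R) t : fine_borel_partition K d C t ->
  resolution_of_identity ip (fun j => E (C j)).
Proof. by move=> [? ? ? ? ?]; exact: pvm_resolution. Qed.

Lemma fbp_sub d n (C : 'I_n -> set R) t j : fine_borel_partition K d C t -> K (t j).
Proof. by move=> [_ _ <- Ct _]; exists j. Qed.

Lemma fbp_le d d' n (C : 'I_n -> set R) t : d <= d' ->
  fine_borel_partition K d C t -> fine_borel_partition K d' C t.
Proof. by move=> dd [? ? ? ? fine]; split=> // j s /fine/lt_le_trans; exact. Qed.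

(** The simple function from the spectral integral is compared with the tagged step operator over
    the common refinement. Where two cells meet, a common point [s] links [c i] to the tag [t j], at
    a cost of [e / 3] on either side. *)
Lemma approximable_id A : spectral_integral K E iota A -> approximable A iota.
Proof.
move=> EA e e0; have e30 : 0 < e / 3%:R by rewrite divr_gt0.
have [d d0 de] := gt0_of_real e30; exists d => // n C t Ct x.
have [m [B [c [Bb [Bt BK] Bc cA]]]] := EA _ e30.
have Bres := pvm_resolution Bb Bt BK.
have Cres := fbp_resolution Ct.
rewrite [e in e * _]split_thirds mulrDl -(subrK (step_operator (fun i => E (B i)) c x) (A x)) -addrA.
apply: (le_trans (ler_normD _ _)); apply: lerD; first exact: cA.
apply: (norm_step_operatorB (ip := ip)) => //.
- by move=> i j y; apply: pvm_commute => //; exact: (fbp_borel Ct).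
- by rewrite addr_ge0 // ltW.
(* Disjoint cells have [E (B i) (E (C j) y) = 0], so they impose no bound. *)
move=> i j; have [BC0|/set0P[s [Bis Cjs]] _] := eqVneq (B i `&` C j) set0.
  rewrite -(pvm_setI E_pvm) ?BC0 ?(pvm_set0 E_pvm) ?eqxx //.
  exact: (fbp_borel Ct).
rewrite /= -(subrK (iota s) (c i)) -addrA (le_trans (ler_normD _ _)) // lerD //.
  by rewrite distrC Bc.
by rewrite -rmorphB normr_of_real de ler_of_real ltW // (fbp_fine Ct).
Qed.

Lemma approximable_one : approximable idfun (fun=> 1).
Proof.
move=> e e0; exists 1 => // n C t Ct x.
have -> : step_operator (fun j => E (C j)) ((fun=> 1) \o t) x = x.
  rewrite -[RHS](roi_sum (fbp_resolution Ct)).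
  by apply: eq_bigr => j _; rewrite scale1r.
by rewrite subrr normr0 mulr_ge0 // ltW.
Qed.

Lemma approximable_lin a T U f g : approximable T f -> approximable U g ->
  approximable (fun x => a *: T x + U x) (fun t => a * f t + g t).
Proof.
move=> Tf Ug e e0; have e20 : 0 < e / 2%:R by rewrite divr_gt0.
have a1 : 0 < `|a| + 1 by rewrite ltr_wpDl.
have [d d0 Td] := Tf (e / 2%:R / (`|a| + 1)) (divr_gt0 e20 a1).
have [d' d'0 Ud] := Ug (e / 2%:R) e20.
exists (Num.min d d') => [|n C t Ct x]; first by rewrite lt_min d0 d'0.
have Cd : fine_borel_partition K d C t by apply: fbp_le Ct; rewrite ge_min lexx.
have Cd' : fine_borel_partition K d' C t.
  by apply: fbp_le Ct; rewrite ge_min lexx orbT.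
rewrite (step_operatorP (fun j => E (C j)) a (f \o t) (g \o t)).
rewrite opprD addrACA -scalerBr [e in e * _]splitr mulrDl.
rewrite (le_trans (ler_normD _ _)) // lerD ?Ud // normrZ.
rewrite (le_trans (ler_wpM2l _ (Td _ _ _ Cd x))) // mulrA ler_wpM2r //.
by rewrite mulrA ler_pdivrMr // mulrC ler_wpM2l ?ltW // ltrDl.
Qed.

(** With [Sf] and [Sg] the step operators, [T U - Sf Sg = T (U - Sg) + (T - Sf) Sg], and [Sg] is
    bounded by [Mg]. *)
Lemma approximable_mul T U f g MT Mg : linear T -> 0 <= MT -> 0 <= Mg ->
  (forall x, `|T x| <= MT * `|x|) -> (forall t, K t -> `|g t| <= Mg) ->
  approximable T f -> approximable U g ->
  approximable (T \o U) (fun t => f t * g t).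
Proof.
move=> Tlin MT0 Mg0 TM gM Tf Ug e e0.
have M1 : 0 < MT + Mg + 1 by rewrite ltr_wpDl ?addr_ge0.
have e10 := divr_gt0 e0 M1.
have [d d0 Td] := Tf _ e10; have [d' d'0 Ud] := Ug _ e10.
exists (Num.min d d') => [|n C t Ct x]; first by rewrite lt_min d0 d'0.
have Cd : fine_borel_partition K d C t by apply: fbp_le Ct; rewrite ge_min lexx.
have Cd' : fine_borel_partition K d' C t.
  by apply: fbp_le Ct; rewrite ge_min lexx orbT.
rewrite (step_operatorM (fbp_resolution Ct) (f \o t) (g \o t)) /=.
set Sg := step_operator _ (g \o t) x.
have TB : T (U x) - T Sg = T (U x - Sg).
  by rewrite -scaleN1r addrC -Tlin scaleN1r addrC.
rewrite -(subrK (T Sg) (T (U x))) -addrA TB.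
apply: (@le_trans _ _ (MT * (e / (MT + Mg + 1) * `|x|) + e / (MT + Mg + 1) * (Mg * `|x|))).
  rewrite (le_trans (ler_normD _ _)) // lerD //.
    by rewrite (le_trans (TM _)) // ler_wpM2l // Ud.
  rewrite (le_trans (Td _ _ _ Cd _)) // ler_wpM2l ?(ltW e10) //.
  apply: (norm_step_operator ip_norm (fbp_resolution Ct)) => // j _ /=.
  by rewrite gM //; exact: fbp_sub Ct.
have -> (q : F) : MT * (q * `|x|) + q * (Mg * `|x|) = q * (MT + Mg) * `|x|.
  by rewrite mulrDr mulrDl !mulrA (mulrC MT).
rewrite ler_wpM2r // mulrAC ler_pdivrMr //.
by rewrite ler_wpM2l ?(ltW e0) // lerDl.
Qed.

(** The error is split as [e / 4 + e / 2 + e / 4]: from [T] to [U], from [U] to its step operator,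
    and between the step operators of [g] and [f]. *)
Lemma approximable_unif T f :
  (forall e : F, 0 < e -> exists U g, [/\ approximable U g,
     forall t, K t -> `|f t - g t| <= e & forall x, `|T x - U x| <= e * `|x|]) ->
  approximable T f.
Proof.
move=> Tf e e0; have e20 : 0 < e / 2%:R by rewrite divr_gt0.
have e40 : 0 < e / 2%:R / 2%:R by rewrite divr_gt0.
have [U [g [Ug fg TU]]] := Tf _ e40; have [d d0 Ud] := Ug _ e20.
exists d => // n C t Ct x.
set S := step_operator (fun j => E (C j)).
have SB : S (g \o t) x - S (f \o t) x = S (fun j => g (t j) - f (t j)) x.
  by rewrite /S /step_operator -sumrB; apply: eq_bigr => ij _; rewrite scalerBl.
have -> : T x - S (f \o t) x
    = (T x - U x) + (U x - S (g \o t) x) + (S (g \o t) x - S (f \o t) x).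
  by rewrite !addrA !subrK.
have -> : e = e / 2%:R / 2%:R + e / 2%:R + e / 2%:R / 2%:R.
  by rewrite addrAC -splitr -splitr.
rewrite !mulrDl (le_trans (ler_normD _ _)) // lerD //.
  by rewrite (le_trans (ler_normD _ _)) // lerD ?Ud.
rewrite SB (norm_step_operator ip_norm (fbp_resolution Ct)) ?(ltW e40) // => j _.
by rewrite distrC fg //; exact: fbp_sub Ct.
Qed.

End SpectralMeasure.

(** * The two functional calculi *)

Lemma continuous_of_real (R : realType) (k : scalar_kind) : continuous (@of_real R k).
Proof.
move=> x; apply/cvgrPdist_lt => e /gt0_of_real[r r0 ->].
near=> y; rewrite -rmorphB normr_of_real ltr_of_real.
by near: y; apply: cvgr_dist_lt.
Unshelve. all: by end_near. Qed.

Section ContinuousCalculus.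
Variables (R : realType) (k : scalar_kind).
Local Notation F := (scalars R k).
Local Notation iota := (@of_real R k).
Variables (H : normedModType F) (ip : {dot H for @conj_scalar R k}).
Hypothesis ip_norm : forall x : H, `|x| ^+ 2 = ip x x.
Variables (A : H -> H) (Phi : (R -> F) -> H -> H).
Hypothesis Phi_calculus : continuous_calculus ip A Phi.
Local Notation K := (real_spectrum A).

(** The isometry carries the bound of [Phi f] back to [f]. Compactness of the spectrum is derived
    from this, so it cannot be used here. *)
Lemma calculus_bound f : {within K, continuous f} -> exists M : F,
  [/\ 0 <= M, forall t, K t -> `|f t| <= M & forall x, `|Phi f x| <= M * `|x|].
Proof.
move=> fc; have [_ [M fM]] := cc_bounded Phi_calculus fc.
(* [M] itself may fail to be nonnegative, but [M * |x|] dominates a norm and hence equals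
   [|M| * |x|]. *)
have fM' x : `|Phi f x| <= `|M| * `|x|.
  have := le_trans (normr_ge0 _) (fM x) => /ger0_norm; rewrite normrM normr_id => ->.
  exact: fM.
by exists `|M|; split=> //; apply/(cc_isometry Phi_calculus fc).
Qed.

Lemma continuous_within_of_real : {within K, continuous iota}.
Proof. by apply: continuous_subspaceT; exact: continuous_of_real. Qed.

(** The previous bound is applied to the identity function. *)
Lemma real_spectrum_bounded : exists M : R, forall t, K t -> `|t| <= M.
Proof.
have [M [/ge0_of_real[m _ ->] KM _]] := calculus_bound continuous_within_of_real.
by exists m => t /KM; rewrite normr_of_real ler_of_real.
Qed.

Lemma real_spectrum_closed : closed K.
Proof.
move=> s Ks; apply: contrapT => nKs.
(* A continuous function on K is bounded, as [Phi] maps it to a bounded operator;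
   the function below would not be if s were a limit point outside K. *)
pose g t := iota (t - s)^-1.
have gc : {within K, continuous g}.
  apply/continuous_in_subspaceT => t /set_mem Kt.
  apply: (@continuous_comp _ _ _ (fun t => (t - s)^-1) iota); last exact: continuous_of_real.
  apply: cvgV; last by apply: cvgB; [exact: cvg_id | exact: cvg_cst].
  by rewrite subr_eq0; apply: contra_notN nKs => /eqP <-.
have [M [/ge0_of_real[m m0 ->] gM _]] := calculus_bound gc.
have m1 : 0 < m + 1 by rewrite ltr_wpDl.
have : nbhs s (ball s (m + 1)^-1) by apply: nbhsx_ballx; rewrite invr_gt0.
move=> /Ks[t [Kt]]; rewrite /ball /= distrC => ts.
have ts0 : 0 < `|t - s|.
  by rewrite normr_gt0 subr_eq0; apply: contra_notN nKs => /eqP <-.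
have := gM t Kt; rewrite normr_of_real ler_of_real normfV => tsm.
have : m + 1 < `|t - s|^-1 by rewrite -[m + 1]invrK ltf_pV2 ?posrE ?invr_gt0.
by move=> /lt_le_trans/(_ tsm); rewrite gtrDl ltr10.
Qed.

Lemma real_spectrum_compact : compact K.
Proof.
have [M KM] := real_spectrum_bounded.
apply: (subclosed_compact real_spectrum_closed (@segment_compact _ (- M) M)).
by move=> t /KM; rewrite /= in_itv /= ler_norml.
Qed.

Lemma continuous_calculusB f g x :
  {within K, continuous f} -> {within K, continuous g} ->
  Phi f x - Phi g x = Phi (fun t => -1 * g t + f t) x.
Proof. by move=> fc gc; rewrite (cc_linear Phi_calculus) // scaleN1r addrC. Qed.

Lemma within_continuous_lin (a : F) (f g : R -> F) :
  {within K, continuous f} -> {within K, continuous g} ->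
  {within K, continuous (fun t => a * f t + g t)}.
Proof.
move=> fc gc t; apply: cvgD; last exact: gc.
by apply: cvgM; [exact: cvg_cst | exact: fc].
Qed.

Lemma within_continuous_mul (f g : R -> F) :
  {within K, continuous f} -> {within K, continuous g} ->
  {within K, continuous (fun t => f t * g t)}.
Proof. by move=> fc gc t; apply: cvgM; [exact: fc | exact: gc]. Qed.

(** * Step operators converge to the continuous calculus, and their forms are Henstock-Kurzweil
    sums *)

Variable E : set R -> H -> H.
Hypothesis E_pvm : projection_valued_measure ip K E.
Hypothesis E_integral : spectral_integral K E iota A.

Lemma calculus_approximable f : {within K, continuous f} ->
  approximable K E (Phi f) f.
Proof.
(* Continuity is carried along because the laws of [Phi] are available for continuous functions
   only. *)
move=> fc; pose S g := {within K, continuous g} /\ approximable K E (Phi g) g.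
have S_one : S (fun=> 1).
  split; first by apply: continuous_subspaceT => t; exact: cvg_cst.
  have -> : Phi (fun=> 1) = idfun by apply/funext => x; exact: (cc_one Phi_calculus).
  exact: approximable_one E_pvm.
have S_lin a g h : S g -> S h -> S (fun t => a * g t + h t).
  move=> [gc gS] [hc hS]; split; first exact: within_continuous_lin.
  have -> : Phi (fun t => a * g t + h t) = fun x => a *: Phi g x + Phi h x.
    by apply/funext => x; exact: (cc_linear Phi_calculus).
  exact: approximable_lin.
have S_mul g h : S g -> S h -> S (fun t => g t * h t).
  move=> [gc gS] [hc hS]; split; first exact: within_continuous_mul.
  have -> : Phi (fun t => g t * h t) = Phi g \o Phi h.
    by apply/funext => x; exact: (cc_mul Phi_calculus).
  have [Mg [Mg0 _ gM]] := calculus_bound gc.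
  have [Mh [Mh0 hM _]] := calculus_bound hc.
  apply: (approximable_mul ip_norm E_pvm _ Mg0 Mh0) => //.
  by case: (cc_bounded Phi_calculus gc).
have S_const c : S (fun=> c).
  have -> : (fun=> c) = (fun t : R => (c - 1) * (fun=> 1) t + (fun=> 1) t).
    by apply/funext => t; rewrite mulr1 subrK.
  exact: S_lin.
have S_id : S iota.
  split; first exact: continuous_within_of_real.
  have -> : Phi iota = A by apply/funext => x; exact: (cc_id Phi_calculus).
  exact: (approximable_id ip_norm E_pvm).
have [M [_ fM _]] := calculus_bound fc.
apply: (approximable_unif ip_norm E_pvm) => e e0.
have [g [gc gS] fg] :=
  weierstrass S_const S_id S_lin S_mul real_spectrum_compact fc fM e0.
exists (Phi g), g; split=> // x; rewrite continuous_calculusB //.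
(* The isometry turns the uniform distance between [f] and [g] into an operator-norm distance. *)
have [Phi_le _] := cc_isometry Phi_calculus 
  (within_continuous_lin (a := -1) gc fc) (ltW e0).
apply: Phi_le => t Kt; rewrite mulN1r addrC; exact: fg.
Qed.

(** A cell is the trace of an interval on the spectrum, hence Borel because the spectrum is
    closed. *)
Lemma tagged_fine_borel d n (C : 'I_n -> set R) t :
  tagged_partition K C t -> gauge_fine K (fun=> d) C t ->
  fine_borel_partition K d C t.
Proof.
move=> [[p _ cell] CK Ct tag] fine; split=> //.
- move=> j; have [i [b [b' [_ ->]]]] := cell j; split; last by move=> s [].
  apply: measurableI; last exact: measurable_itv.
  by apply: measurable_realfun.closed_measurable; exact: real_spectrum_closed.
- move=> j s /fine[/=]; rewrite in_itv /= => /andP[ts st] _.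
  by rewrite ltr_norml; lra.
Qed.

Lemma hk_sum_step f n (C : 'I_n -> set R) t x y :
  hk_sum f (spectral_form ip E x y) C t
  = ip (step_operator (fun j => E (C j)) (f \o t) x) y.
Proof.
rewrite /hk_sum /step_operator linear_sumlz; apply: eq_bigr => j _.
by rewrite linearZl_LR.
Qed.

(** Cauchy-Schwarz keeps [|x|] and [|y|] as factors of the error, so one constant gauge serves both
    fixed vectors and the whole unit ball. *)
Lemma hk_sum_calculus f : {within K, continuous f} -> forall e : F, 0 < e ->
  exists2 d : R, 0 < d & forall n (C : 'I_n -> set R) t,
    tagged_partition K C t -> gauge_fine K (fun=> d) C t -> forall x y,
    `|hk_sum f (spectral_form ip E x y) C t - ip (Phi f x) y| <= e * `|x| * `|y|.
Proof.
move=> fc e e0; have [d d0 fd] := calculus_approximable fc e0.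
exists d => // n C t Ct Cf x y.
rewrite hk_sum_step distrC -linearBl.
rewrite (le_trans (cauchy_schwarz ip_norm _ _)) // ler_wpM2r //.
by apply: fd; exact: tagged_fine_borel.
Qed.

Lemma hk_integral_calculus f x y : {within K, continuous f} ->
  hk_integral K (spectral_form ip E x y) f (ip (Phi f x) y).
Proof.
(* Adding 1 keeps the divisor positive when [x] or [y] is 0, and makes the final estimate strict. *)
move=> fc e e0; have xy0 : 0 < `|x| * `|y| + 1 by rewrite ltr_wpDl // mulr_ge0.
have [d d0 fd] := hk_sum_calculus fc (divr_gt0 e0 xy0).
exists (fun=> d); split=> // n C t Ct Cf.
rewrite (le_lt_trans (fd _ _ _ Ct Cf x y)) // -mulrA mulrAC ltr_pdivrMr //.
by rewrite ltr_pM2l // ltrDl.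
Qed.

Lemma hk_integral_unit_ball_calculus f : {within K, continuous f} ->
  hk_integral_unit_ball K (spectral_form ip E) f (fun x y => ip (Phi f x) y).
Proof.
move=> fc e e0; have e20 : 0 < e / 2%:R by rewrite divr_gt0.
have [d d0 fd] := hk_sum_calculus fc e20.
exists (fun=> d); split=> // x y x1 y1 n C t Ct Cf.
rewrite (le_lt_trans (fd _ _ _ Ct Cf x y)) // -mulrA.
rewrite (@le_lt_trans _ _ (e / 2%:R)) //.
  by rewrite -[leRHS]mulr1 ler_wpM2l ?(ltW e20) // mulr_ile1.
by rewrite ltr_pdivrMr // ltr_pMr // ltr1n.
Qed.

(** A partition fine for the minimum of two gauges is fine for both, so a single sum lies within
    [e / 2] of [I] and of [J]. *)
Lemma hk_integral_unique mu (f : R -> F) (I J : F) :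
  hk_integral K mu f I -> hk_integral K mu f J -> I = J.
Proof.
move=> fI fJ; apply/eqP; rewrite -subr_eq0 -normr_le0; apply/ler_addgt0Pr => e e0.
have e20 : 0 < e / 2%:R by rewrite divr_gt0.
have [g [gg gI]] := fI _ e20; have [h [hg hJ]] := fJ _ e20.
have [M KM] := real_spectrum_bounded.
have [||n [C [t [Ct Cf]]]] := @cousin R K (fun t => Num.min (g t) (h t)) M _ KM.
- exact: real_spectrum_closed.
- by move=> s Ks; rewrite lt_min gg ?hg.
have fine l : (forall s, Num.min (g s) (h s) <= l s) -> gauge_fine K l C t.
  move=> gl j s /Cf[/=]; rewrite in_itv /= => /andP[ts st] Ks; split=> //=.
  by have := gl (t j); rewrite in_itv /=; lra.
rewrite add0r (splitr e) -(subrK (hk_sum f mu C t) I) -addrA.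
apply: (le_trans (ler_normD _ _)); apply: lerD; apply: ltW.
  by rewrite distrC; apply: gI => //; apply: fine => s; rewrite ge_min lexx.
by apply: hJ => //; apply: fine => s; rewrite ge_min lexx orbT.
Qed.

Lemma hk_calculusE f : {within K, continuous f} -> hk_calculus ip K E f = Phi f.
Proof.
move=> fc; rewrite /hk_calculus; set T := get _.
have [_ TI] : [set T : H -> H | bounded_operator T /\
    forall x y, hk_integral K (spectral_form ip E x y) f (ip (T x) y)] T.
  (* [Phi f] witnesses that the set is inhabited, so [get] does not return its default value. *)
  apply: getI; split; first exact: (cc_bounded Phi_calculus fc).
  by move=> x y; exact: hk_integral_calculus.
apply/funext => x; apply: (ip_inj ip_norm) => y.
exact: (hk_integral_unique (TI x y) (hk_integral_calculus x y fc)).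
Qed.

End ContinuousCalculus.

Theorem theorem4p2 (R : realType) (k : scalar_kind)
    (H : completeNormedModType (scalars R k))
    (ip : {dot H for @conj_scalar R k})
    (ip_norm : forall x : H, `|x| ^+ 2 = ip x x)
    (A : H -> H) (A_bounded : bounded_operator A)
    (A_self_adjoint : self_adjoint ip A)
    (E : set R -> H -> H)
    (E_pvm : projection_valued_measure ip (real_spectrum A) E)
    (E_integral : spectral_integral (real_spectrum A) E (@of_real R k) A)
    (PhiC : (R -> scalars R k) -> H -> H)
    (PhiC_calculus : continuous_calculus ip A PhiC)
    (f : R -> scalars R k)
    (f_continuous : {within real_spectrum A, continuous f}) :
  hk_integral_unit_ball (real_spectrum A) (spectral_form ip E) f
    (fun x y => ip (hk_calculus ip (real_spectrum A) E f x) y) /\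
  hk_calculus ip (real_spectrum A) E f = PhiC f.
Proof.
have HK := hk_calculusE ip_norm PhiC_calculus E_pvm E_integral f_continuous.
split=> //; rewrite HK.
exact: (hk_integral_unit_ball_calculus ip_norm PhiC_calculus).
Qed.
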